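(* Let $G$ be a monoid, let $A$ be a $G$-act, and let $S=\bigoplus_{g\in G}S_g$ be a $G$-graded ring. Then the functors $\Gamma$ and $\Lambda$ (defined in the context) are mutually inverse and give an isomorphism of categories $$(G{\int}_S A)\text{-}\mathbf{Mod}\;\cong\; S\# A\text{-}\mathbf{Mod}$$ between the category of $G{\int}_S A$-modules and the category of unital $S\# A$-modules.
   Context: A (left) $G$-act over a monoid $G$ is a set $A$ with an operation $G\times A\to A$ satisfying $(gh)a=g(ha)$ and $1_G a=a$. A $G$-graded ring is a (unital, associative) ring $S=\bigoplus_{g\in G}S_g$ with $S_gS_h\subseteq S_{gh}$ and $1_S\in S_{1_G}$. The action category over $S$, denoted $G{\int}_S A$, is the preadditive category with object set $A$, whose morphisms $a\to b$ are pairs $(a,s)$ with $s\in\bigoplus_{g\in G,\ ga=b}S_g$; composition is $(b,t)\circ(a,s)=(a,ts)$ for $(a,s)\colon a\to b$ and $(b,t)\colon b\to c$. A $G{\int}_S A$-module is an additive functor $G{\int}_S A\to\mathbf{Ab}$; morphisms are natural transformations. The smash product $S\# A$ is the free left $S$-module with basis $\{p_a\mid a\in A\}$ and with multiplication the biadditive extension of: $(s_gp_a)(t_hp_b)=(s_gt_h)p_b$ if $hb=a$, and $0$ otherwise, where $g,h\in G$, $s_g\in S_g$, $t_h\in S_h$, $a,b\in A$. It is a ring possibly without identity. An $S\# A$-module $M$ is unital if $M=(S\# A)M$; $S\# A\text{-}\mathbf{Mod}$ denotes the category of unital $S\# A$-modules and module homomorphisms. The functor $\Gamma$ sends a $G{\int}_S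 A$-module $M$ to $\Gamma M=\bigoplus_{a\in A}M(a)$ with $(sp_a)m=M((a,s))(m_a)$ for $s\in S_g$, $a\in A$, $m=\sum_{b\in A}m_b$ (with $m_b\in M(b)$), and $(\Gamma f)(m)=\sum_{a\in A}f_a(m_a)$ on morphisms. The functor $\Lambda$ sends a unital $S\# A$-module $Q$ to the functor with $(\Lambda Q)(a)=p_aQ$ and, for $s\in S_g$, $(\Lambda Q)((a,s))\colon p_aQ\to p_{ga}Q$, $q\mapsto (sp_a)q$; on morphisms $(\Lambda h)_a(q)=h(q)$. (Direct sums are identified with internal direct sums of their summands.) *)

(* Defs.v *)
From HB Require Import structures.
From mathcomp Require Import all_boot all_algebra.
From mathcomp Require Import finmap.
From mathcomp Require Import boolp classical_sets functions cardinality fsbigop.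

Set Implicit Arguments.
Unset Strict Implicit.
Unset Printing Implicit Defensive.

Import GRing.Theory.
Local Open Scope classical_set_scope.
Local Open Scope ring_scope.

Lemma zmod_morphismD (U V : zmodType) (f : U -> V) :
  zmod_morphism f -> {morph f : x y / x + y}.
Proof.
move=> fB x y; have f0 : f 0 = 0 by rewrite -[0]subr0 fB subrr.
by rewrite -[y in LHS]opprK -[- y]sub0r !fB f0 sub0r opprK.
Qed.

(* The external direct sum of the M i. *)
Record dsum (I : choiceType) (M : I -> zmodType) := DSum {
  dfun :> forall i, M i;
  dfunP : finite_set [set i | dfun i != 0]
}.

HB.instance Definition _ (I : choiceType) (M : I -> zmodType) :=
  gen_eqMixin (dsum M).
HB.instance Definition _ (I : choiceType) (M : I -> zmodType) :=
  gen_choiceMixin (dsum M).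

Section DirectSum.
Variables (I : choiceType) (M : I -> zmodType).
Implicit Types x y z : dsum M.

Lemma dsumP x y : (forall i, x i = y i) -> x = y.
Proof.
case: x y => [f Pf] [g Pg] /= efg; have E : f = g by exact: functional_extensionality_dep.
by rewrite E in Pf *; congr DSum; exact: Prop_irrelevance.
Qed.

Lemma dzero_subproof : finite_set [set i | (0 : M i) != 0].
Proof. by rewrite (_ : [set _ | _] = set0) // -subset0 => i /=; rewrite eqxx. Qed.

Lemma dopp_subproof x : finite_set [set i | - x i != 0].
Proof.
by apply: sub_finite_set (dfunP x) => i /=; rewrite oppr_eq0.
Qed.

Lemma dadd_subproof x y : finite_set [set i | x i + y i != 0].
Proof.
have := dfunP x; have := dfunP y => fy fx.
apply: (@sub_finite_set _ _ ([set i | x i != 0] `|` [set i | y i != 0])).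
  move=> i /= xy0; have [xi0|] := eqVneq (x i) 0; last by left.
  by right; rewrite xi0 add0r in xy0.
by rewrite finite_setU.
Qed.

Definition dzero := DSum dzero_subproof.
Definition dopp x := DSum (dopp_subproof x).
Definition dadd x y := DSum (dadd_subproof x y).

Lemma daddA : associative dadd.
Proof. by move=> x y z; apply: dsumP => i /=; rewrite addrA. Qed.
Lemma daddC : commutative dadd.
Proof. by move=> x y; apply: dsumP => i /=; rewrite addrC. Qed.
Lemma dadd0 : left_id dzero dadd.
Proof. by move=> x; apply: dsumP => i /=; rewrite add0r. Qed.
Lemma daddN : left_inverse dzero dopp dadd.
Proof. by move=> x; apply: dsumP => i /=; rewrite addNr. Qed.

HB.instance Definition _ := GRing.isZmodule.Build (dsum M) daddA daddC dadd0 daddN.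

Lemma dinj_subproof i (u : M i) :
  finite_set [set j | dfwith (fun k => 0 : M k) u j != 0].
Proof.
apply: sub_finite_set (finite_set1 i) => j /=.
by case: dfwithP => [//|k _]; rewrite eqxx.
Qed.

Definition dinj i (u : M i) : dsum M := DSum (dinj_subproof u).

(* The map from the direct sum induced by a family f of additive maps. *)
Definition dlift (V : zmodType) (f : forall i, M i -> V) x : V :=
  \sum_(i \in [set: I]) f i (x i).

Lemma dinj_in i (u : M i) : dinj u i = u.
Proof. by rewrite /= dfwith_in. Qed.

Lemma dinj_out i (u : M i) j : i != j -> dinj u j = 0.
Proof. by move=> ij; rewrite /= dfwith_out. Qed.

Lemma dinjB i (u v : M i) : dinj (u - v) = dinj u - dinj v.
Proof.
apply: dsumP => j /=; case: dfwithP => [|k ik]; first by rewrite !dfwith_in.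
by rewrite !dfwith_out // subr0.
Qed.

Lemma dinj_additive i : zmod_morphism (@dinj i).
Proof. exact: dinjB. Qed.

HB.instance Definition _ i :=
  GRing.isZmodMorphism.Build (M i) (dsum M) (@dinj i) (@dinj_additive i).

Lemma dapp_sum i (r : seq I) (F : I -> dsum M) :
  (\sum_(k <- r) F k) i = \sum_(k <- r) F k i.
Proof.
elim: r => [|k r IH]; first by rewrite !big_nil.
by rewrite !big_cons /= IH.
Qed.

Definition dsupp x : {fset I} := fset_set [set i | x i != 0].

Lemma dsupp_out x i : i \notin dsupp x -> x i = 0.
Proof.
rewrite in_fset_set; last exact: dfunP.
by rewrite notin_setE /= => /negP; rewrite negbK => /eqP.
Qed.

Lemma dsum_decomp x : x = \sum_(i <- dsupp x) dinj (x i).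
Proof.
apply: dsumP => j; rewrite dapp_sum.
have [jx|jx] := boolP (j \in dsupp x); last first.
  rewrite dsupp_out // big_seq big1 // => i ix; rewrite dinj_out //.
  by apply: contraNneq jx => <-.
rewrite (big_fsetD1 j) //= dfwith_in big_seq big1 ?addr0 // => i.
by rewrite !inE => /andP[ij _]; rewrite dfwith_out.
Qed.

Lemma dsum_ind (P : dsum M -> Prop) :
  P 0 -> (forall x y, P x -> P y -> P (x + y)) ->
  (forall i (u : M i), P (dinj u)) -> forall x, P x.
Proof. by move=> P0 PD Pi x; rewrite (dsum_decomp x); elim/big_ind: _. Qed.

Section Lift.
Variables (V : zmodType) (f : forall i, M i -> V).
Arguments f : clear implicits.

Lemma dliftE (A : {fset I}) x : (forall i, f i 0 = 0) ->
  {subset dsupp x <= A} -> dlift f x = \sum_(i <- A) f i (x i).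
Proof.
move=> f0 xA; apply: fsbigTE => i iA; rewrite dsupp_out //.
by apply: contra iA; exact: xA.
Qed.

Hypothesis fB : forall i, zmod_morphism (f i).

Let f0 i : f i 0 = 0. Proof. by rewrite -[0]subr0 fB subrr. Qed.

Lemma dlift_additive : zmod_morphism (dlift f).
Proof.
move=> x y; pose A := (dsupp x `|` dsupp y `|` dsupp (x - y))%fset.
rewrite !(@dliftE A) //; try by move=> i; rewrite !inE => -> //; rewrite ?orbT.
by rewrite -sumrB; apply: eq_bigr => i _; rewrite fB.
Qed.

Lemma dlift_inj i (u : M i) : dlift f (dinj u) = f i u.
Proof.
rewrite (@dliftE [fset i]%fset) //; first by rewrite big_seq_fset1 dinj_in.
move=> j; rewrite in_fset_set; last exact: dfunP.
rewrite inE /= => h; rewrite inE; apply: contraNT h => ji.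
by rewrite dfwith_out // eq_sym.
Qed.

End Lift.

Lemma dliftB_fun (V : zmodType) (f g h : forall i, M i -> V) x :
  (forall i, f i 0 = 0) -> (forall i, g i 0 = 0) -> (forall i, h i 0 = 0) ->
  (forall i u, h i u = f i u - g i u) -> dlift h x = dlift f x - dlift g x.
Proof.
move=> f0 g0 h0 E; rewrite !(@dliftE _ _ (dsupp x)) // -sumrB.
by apply: eq_bigr => i _.
Qed.

End DirectSum.

Record subz (V : zmodType) (H : zmodClosed V) := Subz {
  subz_val :> V;
  subz_valP : subz_val \in H
}.

HB.instance Definition _ (V : zmodType) (H : zmodClosed V) :=
  [isSub for @subz_val V H].
HB.instance Definition _ (V : zmodType) (H : zmodClosed V) :=
  [Choice of subz H by <:].
HB.instance Definition _ (V : zmodType) (H : zmodClosed V) :=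
  [SubChoice_isSubZmodule of subz H by <:].

Lemma subz_valD (V : zmodType) (H : zmodClosed V) (x y : subz H) :
  subz_val (x + y) = subz_val x + subz_val y.
Proof. exact: (raddfD (val : subz H -> V)). Qed.

Lemma subz_valB (V : zmodType) (H : zmodClosed V) (x y : subz H) :
  subz_val (x - y) = subz_val x - subz_val y.
Proof. exact: (raddfB (val : subz H -> V)). Qed.

Record preadditive := Preadditive {
  pobj :> Type;
  phom : pobj -> pobj -> zmodType;
  pid : forall a, phom a a;
  pcomp : forall a b c, phom b c -> phom a b -> phom a c;
  pcomp1l : forall a b (f : phom a b), pcomp (pid b) f = f;
  pcomp1r : forall a b (f : phom a b), pcomp f (pid a) = f;
  pcompA : forall a b c d (h : phom c d) (g : phom b c) (f : phom a b),
    pcomp h (pcomp g f) = pcomp (pcomp h g) f;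
  pcompDl : forall a b c (g g' : phom b c) (f : phom a b),
    pcomp (g + g') f = pcomp g f + pcomp g' f;
  pcompDr : forall a b c (g : phom b c) (f f' : phom a b),
    pcomp g (f + f') = pcomp g f + pcomp g f'
}.

(* A C-module: an additive functor from C to abelian groups. *)
Record pmodule (C : preadditive) := PModule {
  pm_obj :> C -> zmodType;
  pm_map : forall a b, phom a b -> {additive pm_obj a -> pm_obj b};
  pm_map1 : forall a (m : pm_obj a), pm_map (pid a) m = m;
  pm_mapM : forall a b c (g : phom b c) (f : phom a b) (m : pm_obj a),
    pm_map (pcomp g f) m = pm_map g (pm_map f m);
  pm_mapD : forall a b (f g : phom a b) (m : pm_obj a),
    pm_map (f + g) m = pm_map f m + pm_map g m
}.

Lemma pm_mapB (C : preadditive) (M : pmodule C) a b (f f' : phom a b) (m : M a) :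
  pm_map M (f - f') m = pm_map M f m - pm_map M f' m.
Proof.
apply/eqP; rewrite eq_sym subr_eq -pm_mapD; apply/eqP.
by congr (pm_map M _ m); rewrite subrK.
Qed.

Record pmod_hom (C : preadditive) (M N : pmodule C) := PModHom {
  pm_app :> forall a, {additive M a -> N a};
  pm_natural : forall a b (f : phom a b) (m : M a),
    pm_app b (pm_map M f m) = pm_map N f (pm_app a m)
}.

Record rng := Rng {
  rng_zmod :> zmodType;
  rng_mul : rng_zmod -> rng_zmod -> rng_zmod;
  rng_mulA : associative rng_mul;
  rng_mulDl : left_distributive rng_mul +%R;
  rng_mulDr : right_distributive rng_mul +%R
}.

Record rmodule (R : rng) := RModule {
  rm_zmod :> zmodType;
  rm_act : R -> rm_zmod -> rm_zmod;
  rm_actA : forall x y m, rm_act (rng_mul x y) m = rm_act x (rm_act y m);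
  rm_actDl : forall x y m, rm_act (x + y) m = rm_act x m + rm_act y m;
  rm_actDr : forall x m n, rm_act x (m + n) = rm_act x m + rm_act x n
}.

(* R M is the subgroup generated by the products x m. *)
Definition unital (R : rng) (M : rmodule R) : Prop :=
  forall m : M, exists s : seq (R * M), m = \sum_(p <- s) rm_act p.1 p.2.

Record rmod_hom (R : rng) (M N : rmodule R) := RModHom {
  rm_app :> {additive M -> N};
  rm_linear : forall x (m : M), rm_app (rm_act x m) = rm_act x (rm_app m)
}.

Record category := Category {
  cobj :> Type;
  chom : cobj -> cobj -> Type;
  cat_id : forall X, chom X X;
  ccomp : forall X Y Z, chom Y Z -> chom X Y -> chom X Z;
  ccomp1l : forall X Y (f : chom X Y), ccomp (cat_id Y) f = f;
  ccomp1r : forall X Y (f : chom X Y), ccomp f (cat_id X) = f;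
  ccompA : forall X Y Z W (h : chom Z W) (g : chom Y Z) (f : chom X Y),
    ccomp h (ccomp g f) = ccomp (ccomp h g) f
}.

Record functor (C D : category) := Functor {
  fobj :> C -> D;
  fmap : forall X Y, chom X Y -> chom (fobj X) (fobj Y);
  fmap1 : forall X, fmap (cat_id X) = cat_id (fobj X);
  fmapM : forall X Y Z (g : chom Y Z) (f : chom X Y),
    fmap (ccomp g f) = ccomp (fmap g) (fmap f)
}.

Definition functor_id (C : category) : functor C C :=
  @Functor C C (fun X => X) (fun _ _ f => f) (fun=> erefl) (fun _ _ _ _ _ => erefl).

Section FunctorComp.
Variables (C D E : category) (K : functor D E) (F : functor C D).

Let fcomp1 (X : C) : fmap K (fmap F (cat_id X)) = cat_id (K (F X)).
Proof. by rewrite !fmap1. Qed.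
Let fcompM (X Y Z : C) (g : chom Y Z) (f : chom X Y) :
  fmap K (fmap F (ccomp g f)) = ccomp (fmap K (fmap F g)) (fmap K (fmap F f)).
Proof. by rewrite !fmapM. Qed.

Definition functor_comp : functor C E :=
  @Functor C E (fun X => K (F X)) (fun _ _ f => fmap K (fmap F f)) fcomp1 fcompM.

End FunctorComp.

Record natiso (C D : category) (F K : functor C D) := NatIso {
  ni_app :> forall X, chom (F X) (K X);
  ni_inv : forall X, chom (K X) (F X);
  ni_natural : forall X Y (f : chom X Y),
    ccomp (ni_app Y) (fmap F f) = ccomp (fmap K f) (ni_app X);
  ni_invK : forall X, ccomp (ni_app X) (ni_inv X) = cat_id (K X);
  ni_appK : forall X, ccomp (ni_inv X) (ni_app X) = cat_id (F X)
}.

Lemma additive_ext (U V : zmodType) (f g : {additive U -> V}) : f =1 g -> f = g.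
Proof.
case: f g => [f [[pf]]] [g [[pg]]] /= fg.
have E : f = g by exact: funext.
by rewrite E in pf *; rewrite (Prop_irrelevance pf pg).
Qed.

Section PModCategory.
Variable C : preadditive.

Lemma pmod_homP (M N : pmodule C) (f g : pmod_hom M N) :
  (forall a, f a =1 g a) -> f = g.
Proof.
case: f g => [f pf] [g pg] /= fg.
have E : f = g.
  by apply: functional_extensionality_dep => a; apply/additive_ext/fg.
by rewrite E in pf *; rewrite (Prop_irrelevance pf pg).
Qed.

Definition pmod_id (M : pmodule C) : pmod_hom M M :=
  @PModHom C M M (fun a => idfun) (fun _ _ _ _ => erefl).

Lemma pmod_comp_natural (M N P : pmodule C) (g : pmod_hom N P)
    (f : pmod_hom M N) a b (u : phom a b) (m : M a) :
  (g b \o f b) (pm_map M u m) = pm_map P u ((g a \o f a) m).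
Proof. by rewrite /= !pm_natural. Qed.

Definition pmod_comp (M N P : pmodule C) (g : pmod_hom N P) (f : pmod_hom M N) :
    pmod_hom M P :=
  @PModHom C M P (fun a => g a \o f a) (pmod_comp_natural g f).

Definition pmod_category : category.
Proof.
refine (@Category (pmodule C) (@pmod_hom C) pmod_id pmod_comp _ _ _);
  by move=> *; apply: pmod_homP.
Defined.

End PModCategory.

Section RModCategory.
Variable R : rng.

Lemma rmod_homP (M N : rmodule R) (f g : rmod_hom M N) : f =1 g -> f = g.
Proof.
case: f g => [f pf] [g pg] /= fg.
have E : f = g by apply/additive_ext/fg.
by rewrite E in pf *; rewrite (Prop_irrelevance pf pg).
Qed.

Definition rmod_id (M : rmodule R) : rmod_hom M M :=
  @RModHom R M M idfun (fun _ _ => erefl).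

Lemma rmod_comp_linear (M N P : rmodule R) (g : rmod_hom N P)
    (f : rmod_hom M N) x (m : M) :
  (g \o f) (rm_act x m) = rm_act x ((g \o f) m).
Proof. by rewrite /= !rm_linear. Qed.

Definition rmod_comp (M N P : rmodule R) (g : rmod_hom N P) (f : rmod_hom M N) :
    rmod_hom M P :=
  @RModHom R M P (g \o f) (rmod_comp_linear g f).

Record umodule := UModule {
  um_rmod :> rmodule R;
  um_unital : unital um_rmod
}.

Definition umod_category : category.
Proof.
refine (@Category umodule (@rmod_hom R) rmod_id (fun M N P => @rmod_comp M N P) _ _ _);
  by move=> *; apply: rmod_homP.
Defined.

End RModCategory.

Record gact (G : monoidType) := GAct {
  ga_set :> choiceType;
  ga_op : G -> ga_set -> ga_set;
  ga_opM : forall g h a, ga_op (g * h)%g a = ga_op g (ga_op h a);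
  ga_op1 : forall a, ga_op 1%g a = a
}.

(* gr_comp g is S_g; gr_decomp says that S is the internal direct sum of the
   S_g. *)
Record graded_ring (G : monoidType) := GradedRing {
  gr_ring :> pzRingType;
  gr_comp : G -> zmodClosed gr_ring;
  gr_compM : forall g h s t,
    s \in gr_comp g -> t \in gr_comp h -> s * t \in gr_comp (g * h)%g;
  gr_comp1 : 1 \in gr_comp 1%g;
  gr_decomp : forall s : gr_ring, exists! c : dsum (fun _ : G => gr_ring : zmodType),
    (forall g, c g \in gr_comp g) /\ s = \sum_(g \in [set: G]) c g
}.

Section GradedTheory.
Variables (G : monoidType) (S : graded_ring G).
Implicit Types (s t : S) (g h : G).

Local Notation gfam := (dsum (fun _ : G => S : zmodType)).

(* The family of homogeneous components of s. *)
Definition gdecomp s : gfam := sval (boolp.cid (gr_decomp s)).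

Lemma gdecompP s g : gdecomp s g \in gr_comp S g.
Proof. by rewrite /gdecomp; case: boolp.cid => c [[]]. Qed.

Lemma gdecomp_sum s : s = \sum_(g \in [set: G]) gdecomp s g.
Proof. by rewrite /gdecomp; case: boolp.cid => c [[]]. Qed.

Lemma gdecompE s (c : gfam) : (forall g, c g \in gr_comp S g) ->
  s = \sum_(g \in [set: G]) c g -> gdecomp s = c.
Proof.
move=> cS sE; rewrite /gdecomp; case: boolp.cid => d /= [_ du].
by apply: du.
Qed.

Lemma gsum_dlift (c : gfam) : \sum_(g \in [set: G]) c g = dlift (fun _ u => u) c.
Proof. by []. Qed.

Lemma gdecompB s t : gdecomp (s - t) = gdecomp s - gdecomp t.
Proof.
apply: gdecompE => [g|]; first by rewrite rpredB // gdecompP.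
by rewrite gsum_dlift dlift_additive // {1}(gdecomp_sum s) {1}(gdecomp_sum t).
Qed.

HB.instance Definition _ :=
  GRing.isZmodMorphism.Build (S : zmodType) gfam gdecomp gdecompB.

Lemma gdecomp_homog g s : s \in gr_comp S g -> gdecomp s = dinj (i := g) s.
Proof.
move=> sg; apply: gdecompE => [h|]; last by rewrite gsum_dlift dlift_inj.
rewrite /=; case: dfwithP => // k _; exact: rpred0.
Qed.

Lemma gr_ind (P : S -> Prop) : P 0 -> (forall s t, P s -> P t -> P (s + t)) ->
  (forall g s, s \in gr_comp S g -> P s) -> forall s, P s.
Proof.
move=> P0 PD Pg s; rewrite (gdecomp_sum s) gsum_dlift (@dliftE _ _ _ _ (dsupp (gdecomp s))) //.
by elim/big_ind: _ => // g _; apply: Pg; apply: gdecompP.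
Qed.

Variable A : gact G.
Implicit Types a b : A.

(* Membership in the internal direct sum of the S_g with g a = b. *)
Definition act_hom_pred a b : {pred S} := fun s =>
  `[< exists c : gfam, (forall g, c g \in gr_comp S g) /\
      s = \sum_(g \in [set g | ga_op g a = b]) c g >].

Lemma act_hom_predP a b s :
  s \in act_hom_pred a b <-> forall g, ga_op g a != b -> gdecomp s g = 0.
Proof.
rewrite /act_hom_pred unfold_in; split.
  move=> /asboolP[c [cS]]; rewrite fsbig_mkcond => sE g gab.
  have fc : finite_set [set g | patch (fun=> 0) [set g | ga_op g a = b] c g != 0].
    apply: sub_finite_set (dfunP c) => h /=; rewrite /patch.
    by case: ifP => //; rewrite eqxx.
  rewrite (@gdecompE s (DSum fc)) //=.
    by rewrite /patch ifF //; apply/negbTE; apply: contra gab => /set_mem/eqP.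
  by move=> h; rewrite /patch; case: ifP => // _; exact: rpred0.
move=> s0; apply/asboolP; exists (gdecomp s); split; first exact: gdecompP.
rewrite fsbig_mkcond [LHS]gdecomp_sum; apply: eq_fsbigr => g _.
rewrite /patch; case: ifPn => // /negP gab; apply: s0.
by apply/negP => /eqP gab'; apply: gab; apply/mem_set.
Qed.

Lemma act_hom_closed a b : zmod_closed (act_hom_pred a b).
Proof.
split=> [|s t /act_hom_predP sab /act_hom_predP tab]; apply/act_hom_predP => g gab.
  by rewrite raddf0.
by rewrite raddfB /= sab // tab // subr0.
Qed.

HB.instance Definition _ a b :=
  GRing.isZmodClosed.Build S (act_hom_pred a b) (act_hom_closed a b).

Definition act_hom a b : zmodType := subz (act_hom_pred a b).

Lemma act_hom_homog a b g s :
  s \in gr_comp S g -> ga_op g a = b -> s \in act_hom_pred a b.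
Proof.
move=> sg gab; apply/act_hom_predP => h hab.
rewrite (gdecomp_homog sg) dinj_out //.
by apply: contraNneq hab => <-; rewrite gab.
Qed.

Lemma act_hom_ind a b (P : S -> Prop) :
  P 0 -> (forall s t, P s -> P t -> P (s + t)) ->
  (forall g s, s \in gr_comp S g -> ga_op g a = b -> P s) ->
  forall s, s \in act_hom_pred a b -> P s.
Proof.
move=> P0 PD Pg s /act_hom_predP sab.
rewrite (gdecomp_sum s) gsum_dlift (@dliftE _ _ _ _ (dsupp (gdecomp s))) //.
elim/big_ind: _ => // g _; have [gab|/sab-> //] := eqVneq (ga_op g a) b.
exact: Pg (gdecompP s g) gab.
Qed.

Lemma act_id_subproof a : (1 : S) \in act_hom_pred a a.
Proof. exact: act_hom_homog (gr_comp1 S) (ga_op1 a). Qed.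

Lemma act_comp_subproof a b c (t : act_hom b c) (s : act_hom a b) :
  subz_val t * subz_val s \in act_hom_pred a c.
Proof.
case: t s => [t tbc] [s sab] /=.
elim/act_hom_ind: tbc => [|t1 t2 H1 H2|h {}t th hbc].
- by rewrite mul0r rpred0.
- by rewrite mulrDl rpredD.
elim/act_hom_ind: sab => [|s1 s2 H1 H2|g {}s sg gab].
- by rewrite mulr0 rpred0.
- by rewrite mulrDr rpredD.
by apply: act_hom_homog (gr_compM th sg) _; rewrite ga_opM gab.
Qed.

Definition act_id a : act_hom a a := Subz (act_id_subproof a).

Definition act_comp a b c (t : act_hom b c) (s : act_hom a b) : act_hom a c :=
  Subz (act_comp_subproof t s).

(* A morphism (a, s) : a -> b is represented by s, its source a being part of
   its type. *)
Definition action_category : preadditive.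
Proof.
refine (@Preadditive A act_hom act_id act_comp _ _ _ _ _);
  move=> *; apply/val_inj => /=.
- exact: mul1r.
- exact: mulr1.
- exact: mulrA.
- by rewrite -mulrDl; congr (_ * _); exact: subz_valD.
- by rewrite -mulrDr; congr (_ * _); exact: subz_valD.
Defined.

(* The underlying group of the free left S-module on {p_a}; smash_el a s is s p_a. *)
Definition smash_zmod : zmodType := dsum (fun _ : A => S : zmodType).

Definition smash_el a s : smash_zmod := dinj (i := a) s.

(* Biadditive extension of (s p_a)(t p_b) = (s t) p_b if h b = a and 0 otherwise,
   for t in S_h: the left factor contributes its coefficient at a = h b. *)
Definition smash_mul (x y : smash_zmod) : smash_zmod :=
  \sum_(b \in [set: A]) \sum_(h \in [set: G])
    smash_el b (x (ga_op h b) * gdecomp (y b) h).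

Lemma smash_elB a : zmod_morphism (smash_el a).
Proof. exact: dinjB. Qed.

HB.instance Definition _ a :=
  GRing.isZmodMorphism.Build (S : zmodType) smash_zmod (smash_el a) (@smash_elB a).

Lemma smash_ind (P : smash_zmod -> Prop) :
  P 0 -> (forall x y, P x -> P y -> P (x + y)) ->
  (forall a g s, s \in gr_comp S g -> P (smash_el a s)) -> forall x, P x.
Proof.
move=> P0 PD Pg; apply: dsum_ind => // a; apply: gr_ind => [|s t Ps Pt|g s sg].
- by rewrite raddf0.
- by rewrite raddfD; apply: PD.
- exact: Pg sg.
Qed.

Let mul_part (x : smash_zmod) b h (u : S) := smash_el b (x (ga_op h b) * u).

Let mul_partB x b h : zmod_morphism (mul_part x b h).
Proof. by move=> u v; rewrite /mul_part mulrBr raddfB. Qed.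

Let mul_coef x b (t : S) := dlift (mul_part x b) (gdecomp t).

Let mul_coefB x b : zmod_morphism (mul_coef x b).
Proof.
by move=> u v; rewrite /mul_coef raddfB /= (dlift_additive (mul_partB x b)).
Qed.

Let smash_mul_lift x y : smash_mul x y = dlift (mul_coef x) y.
Proof. by []. Qed.

Lemma smash_mulBr x : zmod_morphism (smash_mul x).
Proof. by move=> y z; rewrite !smash_mul_lift (dlift_additive (mul_coefB x)). Qed.

Lemma smash_mulBl y : zmod_morphism (smash_mul^~ y).
Proof.
move=> x x'; rewrite !smash_mul_lift.
have mul0 z b : mul_coef z b 0 = 0.
  by rewrite -[0 in LHS]subr0 mul_coefB subrr.
have part0 z b h : mul_part z b h 0 = 0 by rewrite /mul_part mulr0 raddf0.
apply: dliftB_fun => // b u; apply: dliftB_fun => // h v.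
by rewrite /mul_part /= mulrBl raddfB.
Qed.

Lemma smash_mul_el x b h t : t \in gr_comp S h ->
  smash_mul x (smash_el b t) = smash_el b (x (ga_op h b) * t).
Proof.
move=> th; rewrite smash_mul_lift (dlift_inj (mul_coefB x)) /mul_coef.
by rewrite (gdecomp_homog th) (dlift_inj (mul_partB x b)).
Qed.

Lemma smash_mul_elE a b g h s t : s \in gr_comp S g -> t \in gr_comp S h ->
  smash_mul (smash_el a s) (smash_el b t) =
  if ga_op h b == a then smash_el b (s * t) else 0.
Proof.
move=> _ th; rewrite (smash_mul_el _ _ th); case: eqP => [->|/eqP hba].
  by rewrite /smash_el dinj_in.
by rewrite {2}/smash_el dinj_out 1?eq_sym // mul0r raddf0.
Qed.

HB.instance Definition _ x :=
  GRing.isZmodMorphism.Build smash_zmod smash_zmod (smash_mul x) (smash_mulBr x).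

Lemma smash_mulDr : right_distributive smash_mul +%R.
Proof. by move=> x y z; rewrite raddfD. Qed.

Lemma smash_mulDl : left_distributive smash_mul +%R.
Proof.
move=> x y z; exact: (zmod_morphismD (smash_mulBl z)).
Qed.

Lemma smash_mul0 x : smash_mul 0 x = 0.
Proof. by rewrite -[X in smash_mul X _](subrr 0) smash_mulBl subrr. Qed.

Lemma smash_mulA : associative smash_mul.
Proof.
move=> x y z; elim/smash_ind: z => [|z z' Hz Hz'|c k r rk].
- by rewrite !raddf0.
- by rewrite !raddfD /= Hz Hz'.
elim/smash_ind: y => [|y y' Hy Hy'|b h t th].
- by rewrite smash_mul0 raddf0 smash_mul0.
- by rewrite raddfD /= !smash_mulDl raddfD /= Hy Hy'.
rewrite (smash_mul_elE _ _ th rk) (smash_mul_el _ _ th) (smash_mul_el _ _ rk).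
case: eqP => [kcb|/eqP kcb].
  rewrite (smash_mul_el _ _ (gr_compM th rk)) ga_opM kcb mulrA.
  by rewrite {2}/smash_el dinj_in.
by rewrite raddf0 {2}/smash_el dinj_out 1?eq_sym // mul0r raddf0.
Qed.

Definition smash : rng := Rng smash_mulA smash_mulDl smash_mulDr.

Definition smash_p a : smash := smash_el a 1.

End GradedTheory.

Section GammaLambda.
Variables (G : monoidType) (S : graded_ring G) (A : gact G).
Implicit Types (s t : S) (g h : G) (a b : A).

Local Notation actC := (action_category S A).
Local Notation SA := (smash S A).

(* The morphism (a, s_g) : a -> g a, with s_g the component of s in S_g. *)
Definition act_hom_part a g s : act_hom S a (ga_op g a) :=
  Subz (act_hom_homog (gdecompP s g) (erefl (ga_op g a))).

Lemma act_hom_partB a g : zmod_morphism (act_hom_part a g).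
Proof.
move=> s t; apply/val_inj; apply: etrans (esym (subz_valB _ _)).
by rewrite /= raddfB.
Qed.

Lemma act_hom_part_id a g s :
  act_hom_part a g (gdecomp s g) = act_hom_part a g s.
Proof.
by apply/val_inj; rewrite /= (gdecomp_homog (gdecompP s g)) dinj_in.
Qed.

Lemma act_hom_part_homog a g s : s \in gr_comp S g ->
  subz_val (act_hom_part a g s) = s.
Proof. by move=> sg; rewrite /= (gdecomp_homog sg) dinj_in. Qed.

Section GammaObject.
Variable M : pmodule actC.

Definition gamma_zmod : zmodType := dsum (fun a : A => M a).

Definition gamma_el a (m : M a) : gamma_zmod := dinj m.

(* Biadditive extension of (s p_a) m = M((a, s)) m_a for s in S_g, the value
   being placed in the summand M(g a). *)
Definition gamma_act (x : SA) (m : gamma_zmod) : gamma_zmod :=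
  \sum_(a \in [set: A]) \sum_(g \in [set: G])
    gamma_el (pm_map M (act_hom_part a g ((x : smash_zmod S A) a)) (m a)).

Let act_part (m : gamma_zmod) a g s :=
  gamma_el (pm_map M (act_hom_part a g s) (m a)).

Let act_partB m a g : zmod_morphism (act_part m a g).
Proof.
by move=> s t; rewrite /act_part act_hom_partB pm_mapB /gamma_el raddfB.
Qed.

Let act_coef (m : gamma_zmod) a s := dlift (act_part m a) (gdecomp s).

Let act_coefB m a : zmod_morphism (act_coef m a).
Proof.
by move=> u v; rewrite /act_coef raddfB /= (dlift_additive (act_partB m a)).
Qed.

Let gamma_act_lift (x : smash_zmod S A) m :
  gamma_act x m = dlift (act_coef m) x.
Proof.
apply: eq_fsbigr => a _; apply: eq_fsbigr => g _.
by rewrite /act_part act_hom_part_id.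
Qed.

Lemma gamma_actBl m : zmod_morphism (gamma_act^~ m : smash_zmod S A -> gamma_zmod).
Proof.
by move=> x y; rewrite !gamma_act_lift (dlift_additive (act_coefB m)).
Qed.

Lemma gamma_actBr x : zmod_morphism (gamma_act x).
Proof.
move=> m n; rewrite !gamma_act_lift.
have part0 k a g : act_part k a g 0 = 0.
  by rewrite -[0 in LHS]subr0 act_partB subrr.
have act0 k a : act_coef k a 0 = 0.
  by rewrite -[0 in LHS]subr0 act_coefB subrr.
apply: dliftB_fun => // a u; apply: dliftB_fun => // g v.
by rewrite /act_part /gamma_el /= !raddfB.
Qed.

Lemma gamma_act_el a g s m : s \in gr_comp S g ->
  gamma_act (smash_el a s) m = gamma_el (pm_map M (act_hom_part a g s) (m a)).
Proof.
move=> sg; rewrite gamma_act_lift (dlift_inj (act_coefB m)) /act_coef.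
by rewrite (gdecomp_homog sg) (dlift_inj (act_partB m a)).
Qed.

Lemma gamma_el_eq a b c (f : act_hom S a b) (f' : act_hom S a c) (m : M a) :
  b = c -> subz_val f = subz_val f' ->
  gamma_el (pm_map M f m) = gamma_el (pm_map M f' m).
Proof.
move=> bc; case: c / bc f' => f' ff'.
by congr gamma_el; congr (pm_map M _ m); apply/val_inj.
Qed.

HB.instance Definition _ x :=
  GRing.isZmodMorphism.Build gamma_zmod gamma_zmod (gamma_act x) (gamma_actBr x).

Lemma gamma_actDl (x y : SA) m : gamma_act (x + y) m = gamma_act x m + gamma_act y m.
Proof. exact: (zmod_morphismD (gamma_actBl m)). Qed.

Lemma gamma_actDr x m n : gamma_act x (m + n) = gamma_act x m + gamma_act x n.
Proof. by rewrite raddfD. Qed.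

Lemma gamma_act0 m : gamma_act (0 : SA) m = 0.
Proof. by rewrite -[X in gamma_act X _](subrr 0) gamma_actBl subrr. Qed.

Lemma gamma_actA (x y : SA) m :
  gamma_act (smash_mul x y) m = gamma_act x (gamma_act y m).
Proof.
elim/smash_ind: y => [|y y' Hy Hy'|b h t th].
- by rewrite raddf0 !gamma_act0 raddf0.
- by rewrite raddfD /= !gamma_actDl raddfD /= Hy Hy'.
elim/smash_ind: x => [|x x' Hx Hx'|a g s sg].
- by rewrite smash_mul0 !gamma_act0.
- by rewrite smash_mulDl !gamma_actDl Hx Hx'.
rewrite (smash_mul_elE _ _ sg th) (gamma_act_el _ _ th) (gamma_act_el _ _ sg).
case: eqP => [hba|/eqP hba]; last by rewrite gamma_act0 /gamma_el dinj_out // !raddf0.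
case: a / hba; rewrite (gamma_act_el _ _ (gr_compM sg th)) dinj_in -pm_mapM.
apply: gamma_el_eq; first by rewrite ga_opM.
by rewrite act_hom_part_homog ?gr_compM //= !(gdecomp_homog sg, gdecomp_homog th) !dinj_in.
Qed.

Definition gamma_rmodule : rmodule SA :=
  @RModule SA gamma_zmod gamma_act gamma_actA gamma_actDl gamma_actDr.

Lemma gamma_act_p (m : gamma_zmod) a :
  gamma_act (smash_p S a) m = gamma_el (m a).
Proof.
rewrite /smash_p (gamma_act_el _ _ (gr_comp1 S)) -{2}(pm_map1 (m a)).
by apply: gamma_el_eq; rewrite ?ga_op1 // act_hom_part_homog // gr_comp1.
Qed.

Lemma gamma_unital : unital gamma_rmodule.
Proof.
move=> m; exists [seq (smash_p S a, m) | a <- dsupp m].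
by rewrite big_map {1}[m]dsum_decomp; apply: eq_bigr => a _; rewrite /= gamma_act_p.
Qed.

Definition gamma_obj : umodule SA := UModule gamma_unital.

End GammaObject.

Section GammaMorphism.
Variables (M N : pmodule actC) (f : pmod_hom M N).

Definition gamma_map (m : gamma_zmod M) : gamma_zmod N :=
  \sum_(a \in [set: A]) gamma_el (f a (m a)).

Let map_part a (m : M a) : gamma_zmod N := gamma_el (f a m).

Let map_partB a : zmod_morphism (@map_part a).
Proof. by move=> m n; rewrite /map_part /gamma_el !raddfB. Qed.

Let gamma_mapE m : gamma_map m = dlift map_part m.
Proof. by []. Qed.

Lemma gamma_map_el a (m : M a) : gamma_map (gamma_el m) = gamma_el (f a m).
Proof. by rewrite gamma_mapE dlift_inj. Qed.

Lemma gamma_mapB : zmod_morphism gamma_map.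
Proof. by move=> m n; rewrite !gamma_mapE dlift_additive. Qed.

HB.instance Definition _ :=
  GRing.isZmodMorphism.Build (gamma_zmod M) (gamma_zmod N) gamma_map gamma_mapB.

Lemma gamma_map_comp (m : gamma_zmod M) a : gamma_map m a = f a (m a).
Proof.
elim/dsum_ind: m => [|m n Hm Hn|b m].
- by rewrite !raddf0.
- have -> : (m + n) a = m a + n a by [].
  by rewrite (raddfD (f a)) -Hm -Hn raddfD.
rewrite gamma_map_el /=; case: dfwithP => [|c bc]; first by rewrite dfwith_in.
by rewrite dfwith_out // raddf0.
Qed.

Lemma gamma_map_linear (x : SA) (m : gamma_rmodule M) :
  gamma_map (rm_act x m) = rm_act (r := gamma_rmodule N) x (gamma_map m).
Proof.
rewrite /=; elim/smash_ind: x => [|x y Hx Hy|a g s sg].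
- by rewrite !gamma_act0 raddf0.
- by rewrite !gamma_actDl raddfD /= Hx Hy.
by rewrite !(gamma_act_el _ _ sg) gamma_map_el gamma_map_comp pm_natural.
Qed.

Definition gamma_hom : rmod_hom (gamma_obj M) (gamma_obj N) :=
  @RModHom SA (gamma_obj M) (gamma_obj N) gamma_map gamma_map_linear.

End GammaMorphism.

Definition Gamma : functor (pmod_category actC) (umod_category SA).
Proof.
refine (@Functor (pmod_category actC) (umod_category SA) gamma_obj gamma_hom _ _).
- move=> M; apply: rmod_homP => m; apply: dsumP => a.
  exact: gamma_map_comp.
- move=> M N P k f; apply: rmod_homP => m; apply: dsumP => a.
  by rewrite /= !gamma_map_comp.
Defined.

Section LambdaObject.
Variable Q : rmodule SA.

(* Membership in p_a Q. *)
Definition lambda_pred a : {pred Q} := fun q =>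
  `[< exists q' : Q, q = rm_act (smash_p S a) q' >].

Lemma rm_act_additive (x : SA) : zmod_morphism (rm_act (r := Q) x).
Proof.
move=> m n; apply/eqP; rewrite eq_sym subr_eq -rm_actDr; apply/eqP.
by rewrite subrK.
Qed.

Lemma lambda_closed a : zmod_closed (lambda_pred a).
Proof.
split=> [|q r].
  by apply/asboolP; exists 0; rewrite -[X in rm_act _ X](subrr 0) rm_act_additive subrr.
move=> /asboolP[q' ->] /asboolP[r' ->]; apply/asboolP; exists (q' - r').
by rewrite rm_act_additive.
Qed.

HB.instance Definition _ a :=
  GRing.isZmodClosed.Build Q (lambda_pred a) (lambda_closed a).

Definition lambda_zmod a : zmodType := subz (lambda_pred a).

Lemma smash_mul_hom a b c (s : act_hom S a b) (t : act_hom S b c) :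
  smash_mul (smash_el b (subz_val t)) (smash_el a (subz_val s)) =
  smash_el (A := A) a (subz_val t * subz_val s).
Proof.
case: s => s sab; rewrite [subz_val (Subz sab)]/=.
elim/act_hom_ind: sab => [|s1 s2 H1 H2|g {}s sg gab].
- by rewrite mulr0 !raddf0.
- by rewrite mulrDr !raddfD /= H1 H2.
by rewrite (smash_mul_el _ _ sg) gab {1}/smash_el dinj_in.
Qed.

Lemma lambda_map_subproof a b (s : act_hom S a b) (q : lambda_zmod a) :
  rm_act (smash_el a (subz_val s) : SA) (subz_val q) \in lambda_pred b.
Proof.
apply/asboolP; exists (rm_act (smash_el a (subz_val s) : SA) (subz_val q)).
by rewrite -rm_actA /= /smash_p (smash_mul_hom s (act_id S b)) mul1r.
Qed.

Definition lambda_map a b (s : act_hom S a b) (q : lambda_zmod a) : lambda_zmod b :=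
  Subz (lambda_map_subproof s q).

Lemma lambda_mapB a b (s : act_hom S a b) : zmod_morphism (lambda_map s).
Proof.
move=> q r; apply/val_inj; apply: etrans (esym (subz_valB _ _)).
rewrite /= -rm_act_additive.
by congr (rm_act _ _); exact: subz_valB.
Qed.

HB.instance Definition _ a b (s : act_hom S a b) :=
  GRing.isZmodMorphism.Build (lambda_zmod a) (lambda_zmod b)
    (lambda_map s) (@lambda_mapB a b s).

Definition lambda_obj : pmodule actC.
Proof.
refine (@PModule actC lambda_zmod (fun a b (s : act_hom S a b) => lambda_map s) _ _ _).
- move=> a [q qa]; apply/val_inj => /=.
  case/asboolP: (qa) => q' ->; rewrite -rm_actA.
  by rewrite /= /smash_p (smash_mul_hom (act_id S a) (act_id S a)) mul1r.
- move=> a b c t s q; apply/val_inj => /=.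
  by rewrite -rm_actA /= smash_mul_hom.
- move=> a b s t q; apply/val_inj; apply: etrans (esym (subz_valD _ _)).
  rewrite /= -rm_actDl; congr (rm_act _ _).
  by rewrite /= -[RHS]raddfD; congr smash_el; exact: subz_valD.
Defined.

End LambdaObject.

Section LambdaMorphism.
Variables (Q R : rmodule SA) (h : rmod_hom Q R).

Lemma lambda_app_subproof a (q : lambda_zmod Q a) :
  h (subz_val q) \in lambda_pred (Q := R) a.
Proof.
case: q => q /= /asboolP[q' ->]; apply/asboolP; exists (h q').
by rewrite rm_linear.
Qed.

Definition lambda_app a (q : lambda_zmod Q a) : lambda_zmod R a :=
  Subz (lambda_app_subproof q).

Lemma lambda_appB a : zmod_morphism (@lambda_app a).
Proof.
move=> q r; apply/val_inj; apply: etrans (esym (subz_valB _ _)).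
rewrite /= -raddfB.
by congr (h _); exact: subz_valB.
Qed.

HB.instance Definition _ a :=
  GRing.isZmodMorphism.Build (lambda_zmod Q a) (lambda_zmod R a)
    (@lambda_app a) (@lambda_appB a).

Definition lambda_hom : pmod_hom (lambda_obj Q) (lambda_obj R).
Proof.
refine (@PModHom actC (lambda_obj Q) (lambda_obj R) (fun a => @lambda_app a) _).
by move=> a b s q; apply/val_inj; rewrite /= rm_linear.
Defined.

End LambdaMorphism.

Definition Lambda : functor (umod_category SA) (pmod_category actC).
Proof.
refine (@Functor (umod_category SA) (pmod_category actC)
  (fun Q : umodule SA => lambda_obj Q) (fun Q R u => lambda_hom u) _ _).
- by move=> Q; apply: pmod_homP => a q; apply/val_inj.
- by move=> P Q R k f; apply: pmod_homP => a q; apply/val_inj.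
Defined.

End GammaLambda.

(* Main.v *)
(* Because 1 has degree 1, the p_a are orthogonal idempotents of S # A, and
   s p_a = p_b (s p_a) for every morphism s : a -> b.  Hence p_a (Gamma M) is the
   summand M(a) of Gamma M.  For an (S # A)-module Q, orthogonality makes the sum
   of the subgroups p_a Q direct, and it contains every (s p_a) m with s
   homogeneous; so it is all of Q when Q is unital. *)

Require Import Defs.
From HB Require Import structures.
From mathcomp Require Import all_boot all_algebra.
From mathcomp Require Import finmap.
From mathcomp Require Import boolp classical_sets functions cardinality fsbigop.

Local Open Scope classical_set_scope.
Local Open Scope ring_scope.

Import GRing.Theory.

(** * Recovering a module over the action category from its direct sum *)

Section Unit.
Set Implicit Arguments.
Unset Strict Implicit.
Unset Printing Implicit Defensive.

Variables (G : monoidType) (A : gact G) (S : graded_ring G).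
Variable M : pmodule (action_category S A).

(** The action is defined through homogeneous components, but a morphism from [a] to [b] may mix
    several degrees [g] with [g a = b]. This makes the unit commute with all morphisms. *)
Lemma gamma_act_hom (a b : A) (s : act_hom S a b) (m : gamma_zmod M) :
  gamma_act (smash_el a (subz_val s) : smash S A) m = gamma_el (pm_map M s (m a)).
Proof.
case: s => s sab; rewrite [subz_val _]/=.
(* The membership proof is quantified inside the induction predicate because
   the right-hand side depends on it. *)
suff [sab' ->] : exists sab' : s \in act_hom_pred a b,
    gamma_act (smash_el a s : smash S A) m = gamma_el (pm_map M (Subz sab') (m a)).
  by congr (gamma_el (pm_map M _ (m a))); apply/val_inj.
elim/act_hom_ind: {s}sab => [|s t [sab Hs] [tab Ht]|g s sg gab].
- exists (rpred0 _); rewrite raddf0 gamma_act0.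
  (* Writing the zero morphism as a difference lets additivity of [M] on morphisms kill it. *)
  set z := Subz _; have -> : z = z - z by apply/val_inj; rewrite /= subrr.
  by rewrite pm_mapB subrr /gamma_el raddf0.
- exists (rpredD sab tab); rewrite raddfD gamma_actDl Hs Ht /gamma_el -raddfD.
  rewrite -pm_mapD; congr (dinj (pm_map M _ (m a))).
  by apply/val_inj; apply: etrans (subz_valD _ _) _.
exists (act_hom_homog sg gab); rewrite (gamma_act_el _ _ sg).
by apply: gamma_el_eq => //; rewrite act_hom_part_homog.
Qed.

Lemma gamma_el_lambda (a : A) (m : M a) :
  gamma_el m \in lambda_pred (Q := gamma_rmodule M) a.
Proof.
by apply/asboolP; exists (gamma_el m); rewrite /= gamma_act_p /gamma_el dinj_in.
Qed.

Definition unit_app (a : A) (m : M a) : lambda_zmod (gamma_rmodule M) a :=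
  Subz (gamma_el_lambda m).

Lemma unit_appB (a : A) : zmod_morphism (@unit_app a).
Proof.
move=> m n; apply/val_inj; apply: etrans (esym (subz_valB _ _)).
by rewrite /= /gamma_el raddfB.
Qed.

HB.instance Definition _ (a : A) :=
  GRing.isZmodMorphism.Build (M a) (lambda_zmod (gamma_rmodule M) a)
    (@unit_app a) (@unit_appB a).

Definition unit_hom : pmod_hom M (lambda_obj (gamma_obj M)).
Proof.
refine (@PModHom _ M (lambda_obj (gamma_obj M)) (fun a => @unit_app a) _).
by move=> a b s m; apply/val_inj; rewrite /= gamma_act_hom /gamma_el dinj_in.
Defined.

Definition unit_inv_app (a : A) (x : lambda_zmod (gamma_rmodule M) a) : M a :=
  (subz_val x : gamma_zmod M) a.

Lemma unit_inv_appB (a : A) : zmod_morphism (@unit_inv_app a).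
Proof. by move=> x y; rewrite /unit_inv_app subz_valB. Qed.

HB.instance Definition _ (a : A) :=
  GRing.isZmodMorphism.Build (lambda_zmod (gamma_rmodule M) a) (M a)
    (@unit_inv_app a) (@unit_inv_appB a).

Definition unit_inv : pmod_hom (lambda_obj (gamma_obj M)) M.
Proof.
refine (@PModHom _ (lambda_obj (gamma_obj M)) M (fun a => @unit_inv_app a) _).
by move=> a b s x; rewrite /= /unit_inv_app /= gamma_act_hom /gamma_el dinj_in.
Defined.

(** An element of p_a (Gamma M) has the form p_a y, which is concentrated at [a], so its coordinate
    at [a] recovers it. *)
Lemma unit_invK (a : A) (x : lambda_zmod (gamma_rmodule M) a) :
  unit_app (unit_inv_app x) = x.
Proof.
apply/val_inj; case: x => x xa; rewrite /unit_inv_app /=.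
by case/asboolP: (xa) => y ->; rewrite /= gamma_act_p /gamma_el dinj_in.
Qed.

Lemma unit_appK (a : A) (m : M a) : unit_inv_app (unit_app m) = m.
Proof. by rewrite /unit_inv_app /= dfwith_in. Qed.

End Unit.

(** * Recovering a unital module over the smash product from the subgroups p_a Q *)

Section Counit.
Set Implicit Arguments.
Unset Strict Implicit.
Unset Printing Implicit Defensive.

Variables (G : monoidType) (A : gact G) (S : graded_ring G).

Section Map.
Variable Q : rmodule (smash S A).

HB.instance Definition _ (x : smash S A) :=
  GRing.isZmodMorphism.Build Q Q (rm_act x) (rm_act_additive x).

Lemma rm_act0 (q : Q) : rm_act 0 q = 0.
Proof. by apply: (addrI (rm_act 0 q)); rewrite -rm_actDl !addr0. Qed.

(** Orthogonality: since [1] has degree 1 and fixes [b], p_a p_b is p_b if [a = b] and 0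
    otherwise. *)
Lemma smash_p_lambda (a b : A) (q : lambda_zmod Q b) :
  rm_act (smash_p S a) (subz_val q) = if b == a then subz_val q else 0.
Proof.
case: q => q /= /asboolP[q' ->]; rewrite -rm_actA /=.
rewrite (smash_mul_elE _ _ (gr_comp1 S) (gr_comp1 S)) ga_op1 mulr1.
by case: eqP => // _; rewrite rm_act0.
Qed.

Definition counit_map (x : gamma_zmod (lambda_obj Q)) : Q :=
  \sum_(a \in [set: A]) subz_val (x a).

Let val_part (a : A) (q : lambda_obj Q a) : Q := subz_val q.

Let val_partB (a : A) : zmod_morphism (@val_part a).
Proof. by move=> q r; rewrite /val_part subz_valB. Qed.

Lemma counit_mapB : zmod_morphism counit_map.
Proof. exact: (dlift_additive val_partB). Qed.

HB.instance Definition _ :=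
  GRing.isZmodMorphism.Build (gamma_zmod (lambda_obj Q)) Q
    counit_map counit_mapB.

Lemma counit_map_el (a : A) (q : lambda_obj Q a) :
  counit_map (gamma_el q) = subz_val q.
Proof. exact: (dlift_inj val_partB). Qed.

(** By orthogonality p_a picks one summand out of the sum; hence the sum of the p_a Q is direct. *)
Lemma smash_p_counit (x : gamma_zmod (lambda_obj Q)) (a : A) :
  rm_act (smash_p S a) (counit_map x) = subz_val (x a).
Proof.
elim/dsum_ind: x => [|x y Hx Hy|b q].
- by rewrite !raddf0.
- by rewrite !raddfD /= Hx Hy; apply: esym; apply: subz_valD.
rewrite counit_map_el smash_p_lambda; case: eqP => [<-|/eqP ba].
  by rewrite dinj_in.
by rewrite dinj_out.
Qed.

Lemma counit_map_inj : injective counit_map.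
Proof.
move=> x y xy; apply: dsumP => a; apply/val_inj => /=.
by rewrite -!smash_p_counit xy.
Qed.

Lemma counit_map_linear (x : smash S A) (m : gamma_rmodule (lambda_obj Q)) :
  counit_map (rm_act x m) = rm_act x (counit_map m).
Proof.
rewrite /=; elim/smash_ind: x => [|x y Hx Hy|a g s sg].
- by rewrite gamma_act0 rm_act0 raddf0.
- by rewrite gamma_actDl rm_actDl raddfD /= Hx Hy.
rewrite (gamma_act_el _ _ sg) counit_map_el /= (gdecomp_homog sg) dinj_in.
(* The coordinate of [m] at [a] is p_a applied to the sum, and (s p_a) p_a = s p_a. *)
rewrite -smash_p_counit -rm_actA /= (smash_mul_elE _ _ sg (gr_comp1 S)).
by rewrite ga_op1 eqxx mulr1.
Qed.

End Map.

Section Inverse.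
Variable Q : umodule (smash S A).

(** Unitality writes [q] as a sum of products x m, and additivity reduces [x] to s p_a with [s]
    homogeneous. *)
Lemma counit_map_surj (q : Q) : exists x, counit_map x = q.
Proof.
have [r ->] := um_unital q; elim/big_ind: _ => [|_ _ [x <-] [y <-]|[x m] _].
- by exists 0; rewrite raddf0.
- by exists (x + y); rewrite raddfD.
rewrite [_.1]/= [_.2]/=; elim/smash_ind: x => [|x y [u Hu] [v Hv]|a g s sg].
- by exists 0; rewrite raddf0 rm_act0.
- by exists (u + v); rewrite raddfD rm_actDl /= Hu Hv.
(* [s p_a = p_(g a) (s p_a)], so [(s p_a) m] lies in the summand [p_(g a) Q]. *)
have sm : rm_act (smash_el a s : smash S A) m \in lambda_pred (Q := Q) (ga_op g a).
  apply/asboolP; exists (rm_act (smash_el a s : smash S A) m); rewrite -rm_actA /=.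
  by rewrite (smash_mul_elE _ _ (gr_comp1 S) sg) eqxx mul1r.
by exists (gamma_el (M := lambda_obj Q) (Subz sm)); rewrite counit_map_el.
Qed.

(** The preimage is unique by injectivity, and its coordinate at [a] is p_a q; choosing it through
    surjectivity supplies the finite support of this family. *)
Definition counit_inv_map (q : Q) : gamma_zmod (lambda_obj Q) :=
  sval (boolp.cid (counit_map_surj q)).

Lemma counit_invK (q : Q) : counit_map (counit_inv_map q) = q.
Proof. exact: svalP (boolp.cid (counit_map_surj q)). Qed.

Lemma counit_mapK (x : gamma_zmod (lambda_obj Q)) :
  counit_inv_map (counit_map x) = x.
Proof. by apply: (@counit_map_inj Q); rewrite counit_invK. Qed.

Lemma counit_inv_mapB : zmod_morphism counit_inv_map.
Proof.
by move=> q r; apply: (@counit_map_inj Q); rewrite raddfB /= !counit_invK.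
Qed.

HB.instance Definition _ :=
  GRing.isZmodMorphism.Build Q (gamma_zmod (lambda_obj Q))
    counit_inv_map counit_inv_mapB.

Lemma counit_inv_linear (x : smash S A) (q : Q) :
  counit_inv_map (rm_act x q) =
  rm_act (r := gamma_rmodule (lambda_obj Q)) x (counit_inv_map q).
Proof.
by apply: (@counit_map_inj Q); rewrite counit_map_linear !counit_invK.
Qed.

Definition counit_hom : rmod_hom (gamma_obj (lambda_obj Q)) Q :=
  @RModHom _ (gamma_obj (lambda_obj Q)) Q (@counit_map Q) (@counit_map_linear Q).

Definition counit_inv : rmod_hom Q (gamma_obj (lambda_obj Q)) :=
  @RModHom _ Q (gamma_obj (lambda_obj Q)) counit_inv_map counit_inv_linear.

End Inverse.

Lemma counit_natural (Q R : rmodule (smash S A)) (h : rmod_hom Q R)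
    (x : gamma_zmod (lambda_obj Q)) :
  counit_map (gamma_map (lambda_hom h) x) = h (counit_map x).
Proof.
elim/dsum_ind: x => [|x y Hx Hy|a q].
- by rewrite !raddf0.
- by rewrite !raddfD /= Hx Hy.
by rewrite gamma_map_el !counit_map_el.
Qed.

End Counit.

(** Direct sums are external here, so the composites are compared with the identities through the
    canonical identifications: M(a) with its copy in the sum, and the external sum of the p_a Q with
    Q. The equations on [eta] and [eps] pin these down. *)
Theorem theorem2p16 (G : monoidType) (A : gact G) (S : graded_ring G) :
  (exists eta : natiso (functor_id (pmod_category (action_category S A)))
                       (functor_comp (Lambda S A) (Gamma S A)),
     forall (M : pmodule (action_category S A)) (a : A) (m : M a),
       subz_val (pm_app (eta M) a m) = gamma_el m)
  /\
  (exists eps : natiso (functor_comp (Gamma S A) (Lambda S A))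
                       (functor_id (umod_category (smash S A))),
     forall (Q : umodule (smash S A)) (x : gamma_zmod (lambda_obj Q)),
       rm_app (eps Q) x = \sum_(a \in [set: A]) subz_val (x a)).
Proof.
split.
  unshelve eexists.
    refine (@NatIso _ _ (functor_id (pmod_category (action_category S A)))
      (functor_comp (Lambda S A) (Gamma S A))
      (@unit_hom G A S) (@unit_inv G A S) _ _ _).
    - move=> M N f; apply: pmod_homP => a m; apply/val_inj.
      by rewrite /= gamma_map_el.
    - by move=> M; apply: pmod_homP => a x; apply: unit_invK.
    - by move=> M; apply: pmod_homP => a m; apply: unit_appK.
  by [].
unshelve eexists.
  refine (@NatIso _ _ (functor_comp (Gamma S A) (Lambda S A))
    (functor_id (umod_category (smash S A)))
    (@counit_hom G A S) (@counit_inv G A S) _ _ _).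
  - by move=> Q R h; apply: rmod_homP => x; apply: counit_natural.
  - by move=> Q; apply: rmod_homP => q; apply: counit_invK.
  - by move=> Q; apply: rmod_homP => x; apply: counit_mapK.
by [].
Qed.
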